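(* Let $\ell$ be a prime and consider the cyclotomic field $\mathbb{Q}(\zeta_\ell)$. Assume that $\ell-1$ is relatively prime to the order of the class group $C\ell(\mathbb{Q}(\zeta_\ell))$. Let $f$ be a positive divisor of $\ell-1$ which is relatively prime to both $(\ell-1)/f$ and $|\mathrm{Aut}(C\ell(\mathbb{Q}(\zeta_\ell)))|$. Then the exponent of the class group of the subfield of $\mathbb{Q}(\zeta_\ell)$ of degree $f$ over $\mathbb{Q}$ is at most $(\ell-1)/f$.
   Context: $C\ell(\cdot)$ denotes the ideal class group, and $\mathrm{Aut}(\cdot)$ the automorphism group of a group. *)

(* Defs.v *)
From HB Require Import structures.
From mathcomp Require Import all_boot all_order all_algebra all_fingroup.
From mathcomp Require Import all_field.
From mathcomp Require Import finmap.
From mathcomp Require Import mathcomp_extra boolp classical_sets functions.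
From mathcomp Require Import cardinality.

Set Implicit Arguments.
Unset Strict Implicit.
Unset Printing Implicit Defensive.

Import GRing.Theory Num.Theory.

Local Open Scope classical_set_scope.
Local Open Scope ring_scope.

Section Integers.
Variable K : fieldExtType rat.
Implicit Types (x y t : K) (I J M : set K) (s : seq K).

(* The ring of integers O of K: the integral closure of Z in K. *)
Definition integers : set K := [set x | integralOver (intr : int -> K) x].

(* Sub-O-modules of K. *)
Definition submodule M :=
  [/\ M 0, forall x y, M x -> M y -> M (x + y)
    & forall a x, integers a -> M x -> M (a * x)].

Definition ideal_span (S : set K) : set K := smallest submodule S.

(* A fractional ideal of K is a nonzero finitely generated sub-O-module of K;
   invertibility is not assumed, it is proved below (mul_inv_ideal). *)
Definition fractional_ideal I :=
  (exists s, I = ideal_span [set` s]) /\ exists2 x, I x & x != 0.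

Definition mul_ideal I J : set K :=
  ideal_span [set z | exists2 x, I x & exists2 y, J y & z = x * y].

(* The ideal quotient (O : I). *)
Definition inv_ideal I : set K := [set x | forall y, I y -> integers (x * y)].

Lemma integers0 : integers 0. Proof. exact: integral0. Qed.
Lemma integers1 : integers 1. Proof. exact: integral1. Qed.
Lemma integersN x : integers x -> integers (- x). Proof. exact: integral_opp. Qed.
Lemma integersD x y : integers x -> integers y -> integers (x + y).
Proof. exact: integral_add. Qed.
Lemma integersM x y : integers x -> integers y -> integers (x * y).
Proof. exact: integral_mul. Qed.
Lemma integersX x n : integers x -> integers (x ^+ n).
Proof.
by move=> Ox; elim: n => [|n IH]; [exact: integers1 | rewrite exprS; exact: integersM].
Qed.
Lemma integers_int (n : int) : integers n%:~R. Proof. exact: integral_id. Qed.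

Lemma submodule_integers : submodule integers.
Proof. split; [exact: integers0 | exact: integersD | exact: integersM]. Qed.

Lemma ideal_span_sub (S : set K) M : submodule M -> S `<=` M -> ideal_span S `<=` M.
Proof. by move=> subM SM x; apply. Qed.

Lemma sub_ideal_span (S : set K) : S `<=` ideal_span S.
Proof. by move=> x Sx M [_ SM]; apply: SM. Qed.

Lemma submodule_ideal_span (S : set K) : submodule (ideal_span S).
Proof.
split=> [M [[]] //|x y Sx Sy M SM|a x Oa Sx M SM].
  by case: (SM) => -[_ + _] _; apply; [exact: Sx|exact: Sy].
by case: (SM) => -[_ _ +] _; apply => //; exact: Sx.
Qed.
Hint Resolve submodule_ideal_span submodule_integers : core.

Lemma submodule_colon M y : submodule M -> submodule [set x | M (x * y)].
Proof.
move=> [M0 MD MZ]; split=> /=; first by rewrite mul0r.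
  by move=> x z Mx Mz; rewrite mulrDl; apply: MD.
by move=> a x Oa Mx; rewrite -mulrA; apply: MZ.
Qed.

Lemma submodule_colons M (S : set K) :
  submodule M -> submodule [set x | forall y, S y -> M (x * y)].
Proof.
move=> Mm; split=> [y _|x z Mx Mz y Sy|a x Oa Mx y Sy] /=.
- by case: (submodule_colon y Mm).
- by case: (submodule_colon y Mm) => _ D _; apply: D; [exact: Mx|exact: Mz].
- by case: (submodule_colon y Mm) => _ _; apply=> //; exact: Mx.
Qed.

Lemma submodule_mul I J : submodule (mul_ideal I J).
Proof. exact: submodule_ideal_span. Qed.
Hint Resolve submodule_mul : core.

Lemma mem_mul_ideal I J x y : I x -> J y -> mul_ideal I J (x * y).
Proof. by move=> Ix Jy; apply: sub_ideal_span; exists x => //; exists y. Qed.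

Lemma mul_ideal_sub I J M : submodule M ->
  (forall x y, I x -> J y -> M (x * y)) -> mul_ideal I J `<=` M.
Proof. by move=> Mm IJM; apply: ideal_span_sub => // z [x Ix [y Jy ->]]; apply: IJM. Qed.

Lemma mul_idealC I J : mul_ideal I J = mul_ideal J I.
Proof.
by apply/seteqP; split; apply: mul_ideal_sub => // x y Ix Jy; rewrite mulrC;
  apply: mem_mul_ideal.
Qed.

Lemma mul_ideal_le I J I' J' :
  I `<=` I' -> J `<=` J' -> mul_ideal I J `<=` mul_ideal I' J'.
Proof. by move=> II JJ; apply: mul_ideal_sub => // x y /II Ix /JJ; apply: mem_mul_ideal. Qed.

Lemma mul_idealA I J M :
  mul_ideal I (mul_ideal J M) = mul_ideal (mul_ideal I J) M.
Proof.
have le I1 J1 M1 : mul_ideal (mul_ideal I1 J1) M1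
    `<=` mul_ideal I1 (mul_ideal J1 M1).
  apply: mul_ideal_sub => // x z + Mz.
  move: x; apply: mul_ideal_sub; first exact: (submodule_colon z).
  by move=> x y Ix Jy /=; rewrite -mulrA; do 2?apply: mem_mul_ideal.
apply/seteqP; split=> //.
by rewrite mul_idealC (mul_idealC J) (mul_idealC _ M) (mul_idealC I J).
Qed.

Lemma mul_1ideal M : submodule M -> mul_ideal integers M = M.
Proof.
move=> Mm; apply/seteqP; split.
  by case: (Mm) => _ _ MZ; apply: mul_ideal_sub => // x y Ox My; apply: MZ.
by move=> x Mx; rewrite -[x]mul1r; apply: mem_mul_ideal => //; exact: integers1.
Qed.

Lemma ideal_span_mul (S T : set K) : mul_ideal (ideal_span S) (ideal_span T) =
  ideal_span [set z | exists2 x, S x & exists2 y, T y & z = x * y].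
Proof.
apply/seteqP; split.
  apply: mul_ideal_sub => // x y + Ty; move: x.
  apply: ideal_span_sub => [|x Sx /=]; first exact: (submodule_colon y).
  rewrite mulrC; move: y Ty.
  apply: ideal_span_sub => [|y Ty /=]; first exact: (submodule_colon x).
  by apply: sub_ideal_span; rewrite mulrC; exists x => //; exists y.
apply: ideal_span_sub => // _ [x Sx [y Ty ->]].
by apply: mem_mul_ideal; apply: sub_ideal_span.
Qed.

Lemma ideal_span1 : ideal_span [set` [:: 1]] = integers.
Proof.
apply/seteqP; split.
  apply: ideal_span_sub => // x /=; rewrite inE => /eqP->; exact: integers1.
move=> x Ox; rewrite -[x]mulr1.
case: (submodule_ideal_span [set` [:: 1 : K]]) => _ _; apply => //.
by apply: sub_ideal_span; rewrite /= inE.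
Qed.

Definition fingen M := exists s, M = ideal_span [set` s].

Lemma fingen_sub M : fingen M -> submodule M.
Proof. by case=> s ->. Qed.

Lemma fingen_mul I J : fingen I -> fingen J -> fingen (mul_ideal I J).
Proof.
move=> [s ->] [t ->]; exists [seq x * y | x <- s, y <- t].
rewrite ideal_span_mul; congr ideal_span; apply/seteqP; split=> z.
  by move=> [x sx [y ty ->]]; apply: allpairs_f.
by case/allpairsP => -[x y] [sx ty ->]; exists x => //; exists y.
Qed.

Definition invertible M := exists2 N, fingen N & mul_ideal M N = integers.

Lemma invertible_mul I J : invertible I -> invertible J ->
  invertible (mul_ideal I J).
Proof.
move=> [N gN IN] [P gP JP]; exists (mul_ideal P N); first exact: fingen_mul.
by rewrite -mul_idealA (mul_idealA J) JP mul_1ideal //; apply: fingen_sub.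
Qed.

Lemma invertible_divl I J : fingen J -> invertible (mul_ideal I J) ->
  invertible I.
Proof.
move=> gJ [N gN IJN]; exists (mul_ideal J N); first exact: fingen_mul.
by rewrite mul_idealA.
Qed.

(* If a t^(n+1) + p_n t^n + ... + p_0 = 0 with integral coefficients, then a t
   is integral. *)
Lemma integers_lead_mul (p : {poly K}) n t a : (forall i, integers p`_i) ->
  integers a -> \sum_(i < n.+1) p`_i * t ^+ i + a * t ^+ n.+1 = 0 ->
  integers (a * t).
Proof.
move=> Op Oa pt0.
pose q := \poly_(i < n.+1) (p`_i * a ^+ (n - i)).
have szq : (size q < size (('X^(n.+1))%R : {poly K}))%N.
  by rewrite size_polyXn ltnS; exact: size_poly.
apply: (@integral_root_monic _ _ (intr : {rmorphism int -> K}) _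
  ('X^(n.+1) + q)).
- by rewrite monicE lead_coefDl // lead_coefXn.
- rewrite /root hornerD hornerXn horner_poly.
  have -> : \sum_(i < n.+1) p`_i * a ^+ (n - i) * (a * t) ^+ i =
      a ^+ n * \sum_(i < n.+1) p`_i * t ^+ i.
    rewrite mulr_sumr; apply: eq_bigr => i _.
    rewrite exprMn mulrA -(mulrA p`_i) -exprD subnK -1?ltnS //.
    by rewrite (mulrC p`_i) mulrA.
  rewrite exprMn exprSr -mulrA -mulrDr addrC pt0 mulr0 //.
- apply/integral_poly => i; rewrite coefD coefXn coef_poly.
  apply: integersD; first exact: integral_nat.
  by case: ifP => _; [apply: integersM => //; exact: integersX | exact: integers0].
Qed.

Lemma int_poly_root t :
  exists2 p : {poly int}, p != 0 & root (map_poly intr p) t.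
Proof.
have /polyOver1P [q qE] := minPolyOver 1 t.
have [p [a a0 pE]] := rat_poly_scale q.
have q0 : q != 0.
  apply: contra_neq (monic_neq0 (monic_minPoly 1 t)) => q0.
  by rewrite qE q0 rmorph0.
exists p.
  by apply: contra_neq q0 => p0; rewrite pE p0 rmorph0 scaler0.
have := root_minPoly 1 t; rewrite qE pE map_polyZ rootZ; last first.
  by rewrite fmorph_eq0 invr_eq0 intr_eq0.
congr root; rewrite -map_poly_comp; apply: eq_map_poly => m /=.
by rewrite scaler_int.
Qed.

(* If p_n t^n + ... + p_0 = 0 with coprime integers p_i, the inverse of (1, t)
   is generated by the e_m = p_n t^(n-m) + ... + p_m for m >= 1, because e_m and
   t e_m are integral and e_m - t e_(m+1) = p_m. *)
Lemma invertible_1t t : invertible (ideal_span [set` [:: 1; t]]).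
Proof.
have [p0 p0n pt0] := int_poly_root t.
pose p := zprimitive p0.
have {}pt0 : root (map_poly intr p : {poly K}) t.
  move: pt0; rewrite {1}[p0]zpolyEprim map_polyZ rootZ //.
  by rewrite /= -(rmorph_int (in_alg K)) fmorph_eq0 intr_eq0 zcontents_eq0.
pose P : {poly K} := map_poly intr p.
have OP i : integers P`_i by rewrite coef_map; exact: integers_int.
pose n := size P.
pose e m := \sum_(m <= i < n) P`_i * t ^+ (i - m).
have eS m : (m < n)%N -> e m = P`_m + t * e m.+1.
  move=> mn; rewrite /e big_ltn // subnn mulr1; congr (_ + _).
  rewrite mulr_sumr; apply: eq_big_nat => i /andP[mi _].
  by rewrite mulrCA -exprS -subSn.
have e0 : e 0%N = 0.
  have : P.[t] = 0 by apply/eqP.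
  rewrite horner_coef => E; rewrite -[RHS]E.
  by rewrite /e big_mkord; under eq_bigr do rewrite subn0.
have Psplit m : (m <= n)%N ->
    \sum_(i < m) P`_i * t ^+ i + e m * t ^+ m = 0.
  move=> mn; rewrite -[RHS]e0 /e [RHS](big_cat_nat (leq0n m) mn) /= big_mkord.
  congr (_ + _); first by apply: eq_bigr => i _; rewrite subn0.
  rewrite mulr_suml; apply: eq_big_nat => i /andP[mi _].
  by rewrite subn0 -mulrA -exprD subnK.
have Oe m : integers (e m.+1) /\ integers (t * e m.+1).
  suff Oe' k : forall m, (m.+1 + k)%N = n ->
      integers (e m.+1) /\ integers (t * e m.+1).
    case: (ltnP m n) => mn; first by apply: (Oe' (n - m.+1)%N); rewrite subnKC.
    by rewrite /e big_geq ?mulr0; [split; exact: integers0 | exact: leqW].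
  elim: k => [|k IH] {}m mk.
    rewrite addn0 in mk.
    by rewrite /e big_geq ?mulr0 ?mk //; split; exact: integers0.
  have mn : (m.+1 < n)%N by rewrite -mk addnS ltnS leq_addr.
  have Oem : integers (e m.+1).
    rewrite eS //; apply: integersD => //; apply: (IH m.+1 _).2.
    by rewrite addSnnS.
  split=> //; rewrite mulrC; apply: (@integers_lead_mul P m) => //.
  by apply: Psplit; apply: ltnW.
pose s := [seq e i.+1 | i <- iota 0 n].
exists (ideal_span [set` s]); first by exists s.
apply/seteqP; split.
  rewrite ideal_span_mul; apply: ideal_span_sub => // _ [x + [_ /mapP[m _ ->] ->]] /=.
  by rewrite /mkset /= !inE => /orP[] /eqP->; rewrite ?mul1r; case: (Oe m).
set N := mul_ideal _ _.
have Nm : submodule N by exact: submodule_mul.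
have N1 m : (m < n)%N -> N (e m.+1) /\ N (t * e m.+1).
  move=> mn; have es : ideal_span [set` s] (e m.+1).
    by apply: sub_ideal_span; apply: map_f; rewrite mem_iota.
  rewrite -{1}[e m.+1]mul1r; split; apply: mem_mul_ideal => //; apply: sub_ideal_span;
  by rewrite /= !inE eqxx ?orbT.
have NN x : N x -> N (- x).
  move=> Nx; rewrite -mulN1r; case: Nm => _ _; apply => //.
  by apply: integersN; exact: integers1.
have NP m : N P`_m.
  case: (ltnP m n) => mn; last by rewrite nth_default //; case: Nm.
  have -> : P`_m = e m - t * e m.+1 by rewrite eS // addrK.
  case: (Nm) => N0 ND _; apply: ND; last by apply: NN; case: (N1 m mn).
  case: m mn => [|m] mn; first by rewrite e0.
  by case: (N1 m (ltnW mn)).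
suff N1' : N 1.
  move=> x Ox; rewrite -[x]mulr1; case: Nm => _ _; exact.
have : N (zcontents p)%:~R.
  rewrite /zcontents rmorphM /=; case: (Nm) => N0 ND NZ; apply: (NZ).
    exact: integers_int.
  elim/big_ind: _ => //.
  - move=> a b Na Nb; case: (posnP a) => [->|a0]; first by rewrite gcd0n.
    case: (egcdnP b a0) => km kn E _.
    have -> : (Posz (gcdn a b))%:~R = km%:R * a%:R - kn%:R * b%:R :> K.
      by rewrite -!natrM E natrD addrAC subrr add0r.
    apply: (ND); [|apply: NN]; apply: (NZ) => //; exact: (integers_int (Posz _)).
  - move=> i _; have := NP i; rewrite coef_map /=.
    by case: (intP p`_i) => [|k|k] //; rewrite ?abszN //= rmorphN => /NN; rewrite opprK.
rewrite /p zcontents_primitive p0n //.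
Qed.

(* (A + B)(B + C)(C + A) = (A + B + C)(AB + BC + CA), which reduces the
   invertibility of finitely generated ideals to the case of two generators. *)
Lemma pruefer_identity s b c :
  mul_ideal (mul_ideal (ideal_span [set` b :: s]) (ideal_span [set` [:: b; c]]))
    (ideal_span [set` c :: s]) =
  mul_ideal (ideal_span [set` [:: b, c & s]])
    (ideal_span [set` b * c :: [seq b * x | x <- s] ++ [seq c * x | x <- s]]).
Proof.
set T := _ :: _ ++ _.
have Tbc : b * c \in T by rewrite inE eqxx.
have Tb x : x \in s -> b * x \in T by move=> xs; rewrite inE mem_cat map_f ?orbT.
have Tc x : x \in s -> c * x \in T by move=> xs; rewrite inE mem_cat map_f ?orbT.
rewrite !ideal_span_mul; congr ideal_span; apply/seteqP; split=> z.
  move=> [_ [x xP [y yP ->]] [w wP ->]].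
  suff [u uP [t tT E]] : exists2 u, u \in [:: b, c & s] &
      exists2 t, t \in T & x * y * w = u * t.
    by exists u => //; exists t.
  move: xP yP wP; rewrite /mkset /= !inE.
  move=> /orP[/eqP->|xs] /orP[] /eqP-> /orP[/eqP->|ws].
  - by exists b; rewrite ?inE ?eqxx //; exists (b * c); rewrite // ?mulrA.
  - by exists b; rewrite ?inE ?eqxx //; exists (b * w); rewrite ?mulrA ?Tb.
  - by exists c; rewrite ?inE ?eqxx ?orbT //; exists (b * c); rewrite // mulrC.
  - by exists w; rewrite ?inE ?ws ?orbT //; exists (b * c); rewrite // mulrC.
  - by exists x; rewrite ?inE ?xs ?orbT //; exists (b * c); rewrite // ?mulrA.
  - by exists x; rewrite ?inE ?xs ?orbT //; exists (b * w); rewrite ?mulrA ?Tb.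
  - exists c; rewrite ?inE ?eqxx ?orbT //.
    by exists (c * x); rewrite ?Tc // mulrC (mulrC x).
  - by exists x; rewrite ?inE ?xs ?orbT //; exists (c * w); rewrite ?mulrA ?Tc.
move=> [u uP [t tP ->]].
suff [x xP [y yP [w wP E]]] : exists2 x, x \in b :: s &
    exists2 y, y \in [:: b; c] & exists2 w, w \in c :: s & u * t = x * y * w.
  by exists (x * y); [exists x => //; exists y|exists w].
have bP : b \in b :: s by rewrite inE eqxx.
have cP : c \in c :: s by rewrite inE eqxx.
have b2 : b \in [:: b; c] by rewrite inE eqxx.
have c2 : c \in [:: b; c] by rewrite !inE eqxx orbT.
have bsP x : x \in s -> x \in b :: s by rewrite inE orbC => ->.
have csP x : x \in s -> x \in c :: s by rewrite inE orbC => ->.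
move: uP tP; rewrite /mkset /= !inE mem_cat.
move=> uP /or3P[/eqP->|/mapP[x xs ->]|/mapP[x xs ->]];
  case/or3P: uP => [/eqP->|/eqP->|us].
- by exists b => //; exists b => //; exists c => //; rewrite mulrA.
- by exists b => //; exists c => //; exists c => //; rewrite mulrC.
- by exists b => //; exists c => //; exists u; rewrite ?csP // mulrC.
- by exists b => //; exists b => //; exists x; rewrite ?csP // mulrA.
- by exists b => //; exists c => //; exists x; rewrite ?csP // mulrCA mulrA.
- by exists u; rewrite ?bsP //; exists b => //; exists x; rewrite ?csP // mulrA.
- by exists b => //; exists c => //; exists x; rewrite ?csP // mulrA.
- by exists x; rewrite ?bsP //; exists c => //; exists c; rewrite // mulrC (mulrC c).
- by exists u; rewrite ?bsP //; exists c => //; exists x; rewrite ?csP // mulrA.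
Qed.

Lemma invertible_ideal_span s : s != [::] -> all (predC1 0) s ->
  invertible (ideal_span [set` s]).
Proof.
have [n] := ubnP (size s); elim: n s => // n IH [//|b [|c s]] /=.
  move=> _ _; rewrite andbT => b0; exists (ideal_span [set` [:: b^-1]]).
    by exists [:: b^-1].
  rewrite -ideal_span1 ideal_span_mul; congr ideal_span; apply/seteqP; split=> z.
    by move=> [x + [y + ->]]; rewrite /mkset /= !inE => /eqP-> /eqP->; rewrite divff.
  rewrite /mkset /= inE => /eqP->; exists b; first by rewrite /mkset /= inE.
  by exists b^-1; rewrite ?divff // /mkset /= inE.
case: s => [|a s].
  move=> _ _ /and3P[b0 c0 _].
  have -> : ideal_span [set` [:: b; c]] =
      mul_ideal (ideal_span [set` [:: b]]) (ideal_span [set` [:: 1; c / b]]).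
    rewrite ideal_span_mul; congr ideal_span; apply/seteqP; split=> z.
      rewrite /mkset /= !inE => /orP[] /eqP->; exists b;
        do ?by rewrite /mkset /= inE.
        by exists 1; rewrite ?mulr1 // /mkset /= inE eqxx.
      exists (c / b); first by rewrite /mkset /= !inE eqxx orbT.
      by rewrite mulrC divfK.
    move=> [x + [y + ->]]; rewrite /mkset /= !inE => /eqP->.
    by move=> /orP[] /eqP->; rewrite ?mulr1 ?eqxx // mulrC divfK // eqxx orbT.
  apply: invertible_mul; last exact: invertible_1t.
  exists (ideal_span [set` [:: b^-1]]).
    by exists [:: b^-1].
  rewrite -ideal_span1 ideal_span_mul; congr ideal_span; apply/seteqP; split=> z.
    by move=> [x + [y + ->]]; rewrite /mkset /= !inE => /eqP-> /eqP->; rewrite divff.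
  rewrite /mkset /= inE => /eqP->; exists b; first by rewrite /mkset /= inE.
  by exists b^-1; rewrite ?divff // /mkset /= inE.
rewrite !ltnS => sn _ /and4P[b0 c0 a0 s0].
have IH' d : d != 0 -> invertible (ideal_span [set` [:: d, a & s]]).
  by move=> d0; apply: IH => //=; rewrite ?ltnS // [d != 0]d0 [a != 0]a0.
apply: (@invertible_divl _ (ideal_span [set` b * c ::
  [seq b * x | x <- a :: s] ++ [seq c * x | x <- a :: s]])); first by eexists.
rewrite -pruefer_identity; apply: invertible_mul; last exact: IH'.
apply: invertible_mul; first exact: IH'.
by apply: IH => //=; rewrite ?(leq_trans _ sn) // [b != 0]b0 [c != 0]c0.
Qed.

Lemma inv_idealE I N : fingen N -> mul_ideal I N = integers ->
  inv_ideal I = N.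
Proof.
move=> /fingen_sub Nm IN; apply/seteqP; split=> [x Ix|x Nx y Iy]; last first.
  by rewrite mulrC -IN; apply: mem_mul_ideal.
rewrite -[x]mul1r.
have : mul_ideal I N 1 by rewrite IN; exact: integers1.
apply: (@mul_ideal_sub I N [set u | N (u * x)]) => [|y z Iy Nz /=].
  exact: submodule_colon.
rewrite mulrAC; case: Nm => _ _; apply=> //.
by rewrite mulrC; apply: Ix.
Qed.

Lemma fractional_invertible I : fractional_ideal I -> invertible I.
Proof.
move=> [[s ->] [x sx x0]].
have E : ideal_span [set` s] = ideal_span [set` [seq y <- s | y != 0]].
  apply/seteqP; split; apply: ideal_span_sub => // y ys.
    have [->|y0] := eqVneq y 0; first by case: (submodule_ideal_span [set` [seq y <- s | y != 0]]).
    by apply: sub_ideal_span; rewrite /mkset /= mem_filter y0.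
  apply: sub_ideal_span; move: ys; rewrite /mkset /= mem_filter => /andP[_]; exact.
rewrite E; apply: invertible_ideal_span; last exact: filter_all.
apply: contra_neq x0 => s0; move: sx; rewrite E s0 => sx.
apply: (@ideal_span_sub _ [set 0] _ _ _ sx) => //.
by split=> [//|y z -> ->|a y _ ->]; rewrite /= ?addr0 ?mulr0.
Qed.

Lemma mul_inv_ideal I : fractional_ideal I ->
  mul_ideal I (inv_ideal I) = integers.
Proof.
by move=> /fractional_invertible[N gN IN]; rewrite (inv_idealE gN IN).
Qed.

Lemma fractional_integers : fractional_ideal integers.
Proof.
split; first by exists [:: 1]; rewrite ideal_span1.
by exists 1; [exact: integers1|exact: oner_neq0].
Qed.

Lemma fractional_mul I J : fractional_ideal I -> fractional_ideal J ->
  fractional_ideal (mul_ideal I J).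
Proof.
move=> [gI [x Ix x0]] [gJ [y Jy y0]]; split; first exact: fingen_mul.
by exists (x * y); [exact: mem_mul_ideal|exact: mulf_neq0].
Qed.

Lemma fractional_inv I : fractional_ideal I -> fractional_ideal (inv_ideal I).
Proof.
move=> FI; have [N gN IN] := fractional_invertible FI.
rewrite (inv_idealE gN IN); split=> //; apply: contrapT => N0.
have: mul_ideal I N 1 by rewrite IN; exact: integers1.
have /[apply] := @mul_ideal_sub I N [set 0] _ _ 1.
move=> H; suff /eqP: 1 = 0 :> K by rewrite oner_eq0.
apply: H.
  by split=> [//|y z -> ->|a y _ ->]; rewrite /= ?addr0 ?mulr0.
move=> x y Ix Ny; have [->|y0] := eqVneq y 0; first exact: mulr0.
by case: N0; exists y.
Qed.

End Integers.

Section ClassGroup.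
Variable K : fieldExtType rat.

Record frac_ideal := FracIdeal {
  ideal_set :> set K;
  _ : `[< fractional_ideal ideal_set >]
}.
HB.instance Definition _ := [isSub for ideal_set].
HB.instance Definition _ := [Choice of frac_ideal by <:].

Implicit Types I J M : frac_ideal.

Lemma frac_idealP I : fractional_ideal I.
Proof. by case: I => I /= /asboolP. Qed.

Lemma frac_submodule I : submodule I.
Proof. by case: (frac_idealP I) => /fingen_sub. Qed.

Definition frac_mul I J :=
  FracIdeal (asboolT (fractional_mul (frac_idealP I) (frac_idealP J))).
Definition frac_one := FracIdeal (asboolT (fractional_integers K)).
Definition frac_inv I := FracIdeal (asboolT (fractional_inv (frac_idealP I))).

Lemma frac_mulC : commutative frac_mul.
Proof. by move=> I J; apply/val_inj/mul_idealC. Qed.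
Lemma frac_mulA : associative frac_mul.
Proof. by move=> I J M; apply/val_inj/mul_idealA. Qed.
Lemma frac_mul1 : left_id frac_one frac_mul.
Proof. by move=> I; apply/val_inj/mul_1ideal/frac_submodule. Qed.
Lemma frac_mulV : right_inverse frac_one frac_inv frac_mul.
Proof. by move=> I; apply/val_inj/mul_inv_ideal/frac_idealP. Qed.
Lemma frac_1mul : right_id frac_one frac_mul.
Proof. by move=> I; rewrite frac_mulC frac_mul1. Qed.
Lemma frac_Vmul : left_inverse frac_one frac_inv frac_mul.
Proof. by move=> I; rewrite frac_mulC frac_mulV. Qed.

HB.instance Definition _ :=
  isGroup.Build frac_ideal frac_mulA frac_mul1 frac_1mul frac_Vmul frac_mulV.

Definition principal I := exists2 x : K, x != 0 & I = ideal_span [set x] :> set K.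

(* I and J are in the same class: I J^-1 is a principal fractional ideal. *)
Definition ideal_equiv I J := `[< principal (I * J^-1)%g >].

Lemma principal1 : principal 1%g.
Proof.
exists 1; first exact: oner_neq0.
by rewrite -set_cons1 ideal_span1.
Qed.

Lemma principalM I J : principal I -> principal J -> principal (I * J)%g.
Proof.
move=> [x x0 /= IE] [y y0 JE]; exists (x * y); first exact: mulf_neq0.
rewrite /= IE JE ideal_span_mul; congr ideal_span; apply/seteqP; split=> z /=.
  by move=> [_ -> [_ -> ->]].
by move=> ->; exists x => //; exists y.
Qed.

Lemma principalV I : principal I -> principal I^-1%g.
Proof.
move=> [x x0 IE]; exists x^-1; first by rewrite invr_eq0.
apply: inv_idealE; first by exists [:: x^-1]; rewrite set_cons1.
rewrite IE ideal_span_mul -ideal_span1 set_cons1; congr ideal_span; apply/seteqP; split=> z /=.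
  by move=> [_ -> [_ -> ->]]; rewrite divff.
by move=> ->; exists x => //; exists x^-1; rewrite // divff.
Qed.

Lemma ideal_equiv_refl : reflexive ideal_equiv.
Proof. by move=> I; apply/asboolP; rewrite divgg; apply: principal1. Qed.

Lemma ideal_equiv_sym : symmetric ideal_equiv.
Proof.
by move=> I J; apply/asboolP/asboolP => /principalV; rewrite invgF.
Qed.

Lemma ideal_equiv_trans : transitive ideal_equiv.
Proof.
move=> J I M /asboolP IJ /asboolP JM; apply/asboolP.
by have := principalM IJ JM; rewrite mulgA mulgVK.
Qed.

Canonical ideal_equiv_equiv := EquivRel ideal_equiv
  ideal_equiv_refl ideal_equiv_sym ideal_equiv_trans.

Definition class_group := {eq_quot ideal_equiv}%qT.

HB.instance Definition _ := Choice.on class_group.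
HB.instance Definition _ := EqQuotient.on class_group.

Lemma frac_mulgC I J : (I * J = J * I)%g.
Proof. exact: frac_mulC. Qed.

Lemma ideal_equiv_mul I I' J J' : ideal_equiv I I' -> ideal_equiv J J' ->
  ideal_equiv (I * J)%g (I' * J')%g.
Proof.
move=> /asboolP pI /asboolP pJ; apply/asboolP.
suff -> : ((I * J) * (I' * J')^-1 = (I * I'^-1) * (J * J'^-1))%g by exact: principalM.
by rewrite invgM -!mulgA; congr (_ * _)%g; rewrite !mulgA (frac_mulgC _ I'^-1)%g
  !mulgA.
Qed.

Lemma ideal_equiv_inv I I' : ideal_equiv I I' -> ideal_equiv I^-1%g I'^-1%g.
Proof.
move=> /asboolP/principalV; rewrite invgF => pI; apply/asboolP.
by rewrite invgK frac_mulgC.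
Qed.

Definition class_one : class_group := (\pi 1%g)%qT.
Definition class_mul := lift_op2 class_group (fun I J => I * J)%g.
Definition class_inv := lift_op1 class_group (fun I => I^-1)%g.

Lemma pi_class_mul :
  {morph (\pi : frac_ideal -> class_group)%qT : I J / (I * J)%g >-> class_mul I J}.
Proof.
move=> I J; unlock class_mul; apply/eqmodP.
by apply: ideal_equiv_mul; apply/eqmodP; rewrite reprK.
Qed.

Lemma pi_class_inv :
  {morph (\pi : frac_ideal -> class_group)%qT : I / I^-1%g >-> class_inv I}.
Proof.
move=> I; unlock class_inv; apply/eqmodP.
by apply: ideal_equiv_inv; apply/eqmodP; rewrite reprK.
Qed.

Lemma class_mulA : associative class_mul.
Proof.
by elim/quotW=> I; elim/quotW=> J; elim/quotW=> M; rewrite -!pi_class_mul mulgA.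
Qed.
Lemma class_1mul : left_id class_one class_mul.
Proof. by elim/quotW=> I; rewrite -pi_class_mul mul1g. Qed.
Lemma class_mul1 : right_id class_one class_mul.
Proof. by elim/quotW=> I; rewrite -pi_class_mul mulg1. Qed.
Lemma class_mulV : right_inverse class_one class_inv class_mul.
Proof. by elim/quotW=> I; rewrite -pi_class_inv -pi_class_mul mulgV. Qed.
Lemma class_Vmul : left_inverse class_one class_inv class_mul.
Proof. by elim/quotW=> I; rewrite -pi_class_inv -pi_class_mul mulVg. Qed.

HB.instance Definition _ := isGroup.Build class_group
  class_mulA class_1mul class_mul1 class_Vmul class_mulV.

End ClassGroup.

(* The number of elements of A; by convention it is 0 when A is infinite. *)
Definition set_order (T : choiceType) (A : set T) : nat := #|` fset_set A|.

Definition automorphisms (G : groupType) : set (G -> G) :=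
  [set phi : G -> G | bijective phi /\ {morph phi : x y / (x * y)%g}].

(* e is the exponent of G: the least positive e such that x ^+ e = 1 for every
   x; no e qualifies if G has unbounded torsion or an element of infinite
   order. *)
Definition is_exponent (G : groupType) (e : nat) : Prop :=
  [/\ (0 < e)%N, forall x : G, (x ^+ e = 1)%g
    & forall m, (0 < m)%N -> (forall x : G, (x ^+ m = 1)%g) -> (e <= m)%N].

Arguments automorphisms G : clear implicits.
Arguments is_exponent G e : clear implicits.

(* Main.v *)
(* Let c be the class in Cl(K) of an ideal I extended from F, and let
   m = [K : F] = (l-1)/f.  For s in G = Gal(K/Q), the power s^f lies in
   Gal(K/F) and fixes c, while s^m acts on Cl(K) as an automorphism whose order
   divides both f and |Aut(Cl(K))|, so it acts trivially.  As f and m are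
   coprime, c is G-invariant, and c^(l-1) is the class of the norm of I to Q,
   which is principal by Gauss's lemma for contents of polynomials over K.
   Hence c = 1, that is I O_K = (a), and taking norms from K to F gives
   I^m = (N(a)).  (An infinite Cl(K) has order 0 by convention, which is coprime
   to l-1 only if l = 2, and then c^(l-1) = 1 already gives c = 1.) *)
Require Import Defs.
From HB Require Import structures.
From mathcomp Require Import all_boot all_order all_algebra all_fingroup.
From mathcomp Require Import all_field.
From mathcomp Require Import finmap.
From mathcomp Require Import mathcomp_extra boolp classical_sets functions.
From mathcomp Require Import cardinality.
From mathcomp Require Import cyclic ring.

Set Implicit Arguments.
Unset Strict Implicit.
Unset Printing Implicit Defensive.

Import GRing.Theory Num.Theory.
Local Open Scope classical_set_scope.
Local Open Scope ring_scope.

#[local] Hint Resolve submodule_ideal_span submodule_integers submodule_mul : core.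

(** * Classes of fractional ideals *)

Section IdealClass.
Variable K : fieldExtType rat.
Implicit Types I J : frac_ideal K.

Definition ideal_class I : class_group K := (\pi I)%qT.

Lemma ideal_classW (P : class_group K -> Prop) :
  (forall I, P (ideal_class I)) -> forall c, P c.
Proof. by move=> PI; elim/quotW. Qed.

Lemma ideal_classM : {morph ideal_class : I J / (I * J)%g}.
Proof. exact: pi_class_mul. Qed.

Lemma ideal_class_eq I J : ideal_class I = ideal_class J <-> ideal_equiv I J.
Proof. by split=> /eqmodP. Qed.

Lemma ideal_class1P I : ideal_class I = 1%g <-> principal I.
Proof.
have E : (I * 1^-1)%g = I by rewrite invg1 mulg1.
by rewrite -{2}E; split=> [/ideal_class_eq/asboolP|/asboolP/ideal_class_eq].
Qed.

End IdealClass.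

(** * Extension of ideals *)

Section Extension.
Variables (K1 K2 : fieldExtType rat) (i : {rmorphism K1 -> K2}).
Implicit Types (S T I J : set K1).

(** As [i] is injective and fixes the integers, [x] and [i x] are roots of the same integer
    polynomials. *)
Lemma integers_fmorph x : integers (i x) <-> integers x.
Proof.
have E p : root (map_poly intr p) (i x) = root (map_poly intr p) x.
  rewrite -(fmorph_root i) -map_poly_comp; congr (root _ _).
  by apply: eq_map_poly => n /=; rewrite rmorph_int.
by split=> -[p mon_p px0]; exists p; rewrite // ?E // -E.
Qed.

Definition ext_ideal I : set K2 := ideal_span (i @` I).

Lemma submodule_ext_ideal I : submodule (ext_ideal I).
Proof. exact: submodule_ideal_span. Qed.
Hint Resolve submodule_ext_ideal : core.

Lemma ext_ideal_span S : ext_ideal (ideal_span S) = ideal_span (i @` S).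
Proof.
apply/seteqP; split; apply: ideal_span_sub => // _ [x Sx <-]; last first.
  by apply: sub_ideal_span; exists x => //; apply: sub_ideal_span.
suff : ideal_span S `<=` [set x | ideal_span (i @` S) (i x)] by apply.
apply: ideal_span_sub => [|y Sy]; last by apply: sub_ideal_span; exists y.
case: (submodule_ideal_span (i @` S)) => M0 MD MZ.
split=> /= [|y z|a y Oa]; first by rewrite rmorph0.
  by rewrite rmorphD; apply: MD.
by rewrite rmorphM; apply: MZ; apply/integers_fmorph.
Qed.

Lemma ext_ideal_mul I J : submodule I -> submodule J ->
  ext_ideal (mul_ideal I J) = mul_ideal (ext_ideal I) (ext_ideal J).
Proof.
move=> Im Jm; rewrite ext_ideal_span /ext_ideal ideal_span_mul.
congr ideal_span; apply/seteqP; split=> z.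
  move=> [_ [x Ix [y Jy ->]] <-]; exists (i x); first by exists x.
  by exists (i y); [exists y|rewrite rmorphM].
move=> [_ [x Ix <-] [_ [y Jy <-] ->]]; exists (x * y); last by rewrite rmorphM.
by exists x => //; exists y.
Qed.

Lemma ext_integers : ext_ideal (@integers K1) = @integers K2.
Proof.
rewrite -!ideal_span1 ext_ideal_span; congr ideal_span.
by rewrite !set_cons1 image_set1 rmorph1.
Qed.

Lemma ext_fractional I : fractional_ideal I -> fractional_ideal (ext_ideal I).
Proof.
move=> [[s ->] [x Ix x0]]; split; last first.
  by exists (i x); [apply: sub_ideal_span; exists x|rewrite fmorph_eq0].
exists (map i s); rewrite ext_ideal_span; congr ideal_span.
apply/seteqP; split=> [_ [y ys <-]|_ /mapP[y ys ->]]; last by exists y.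
exact: map_f.
Qed.

(* Multiply by the inverse of I. *)
Lemma ext_ideal_contract I x : fractional_ideal I -> ext_ideal I (i x) -> I x.
Proof.
move=> FI Iix; have FJ := fractional_inv FI.
have gI : fingen I by case: FI.
rewrite -[I](@inv_idealE _ (inv_ideal I)) // => [y Jy|]; last first.
  by rewrite mul_idealC mul_inv_ideal.
apply/integers_fmorph; rewrite rmorphM -ext_integers -(mul_inv_ideal FI).
rewrite ext_ideal_mul; [|exact: fingen_sub|by case: FJ => /fingen_sub].
by apply: mem_mul_ideal => //; apply: sub_ideal_span; exists y.
Qed.

Definition ext_frac (I : frac_ideal K1) : frac_ideal K2 :=
  FracIdeal (asboolT (ext_fractional (frac_idealP I))).

Lemma ext_fracM : {morph ext_frac : I J / (I * J)%g}.
Proof. by move=> I J; apply/val_inj/ext_ideal_mul; apply: frac_submodule. Qed.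

Lemma ext_frac1 : ext_frac 1%g = 1%g.
Proof. exact/val_inj/ext_integers. Qed.

Lemma ext_fracV : {morph ext_frac : I / (I^-1)%g}.
Proof.
by move=> I; apply: (@mulIg _ (ext_frac I)); rewrite -ext_fracM !mulVg ext_frac1.
Qed.

Lemma ext_ideal_span1 I x : I = ideal_span [set x] ->
  ext_ideal I = ideal_span [set i x].
Proof. by move=> ->; rewrite ext_ideal_span image_set1. Qed.

Lemma ext_ideal_equiv (I J : frac_ideal K1) : ideal_equiv I J ->
  ideal_equiv (ext_frac I) (ext_frac J).
Proof.
move=> /asboolP[x x0 IJ]; apply/asboolP; exists (i x); first by rewrite fmorph_eq0.
by rewrite -ext_fracV -ext_fracM; apply: ext_ideal_span1.
Qed.

(** Computed on a chosen representative; [ext_ideal_class] shows that the choice does not matter. *)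
Definition ext_class (c : class_group K1) : class_group K2 :=
  ideal_class (ext_frac (generic_quotient.repr c)).

Lemma ext_ideal_class (I : frac_ideal K1) :
  ext_class (ideal_class I) = ideal_class (ext_frac I).
Proof. by apply/ideal_class_eq/ext_ideal_equiv/eqmodP; rewrite reprK. Qed.

Lemma ext_classM : {morph ext_class : c d / (c * d)%g}.
Proof.
elim/ideal_classW=> I; elim/ideal_classW=> J.
by rewrite -ideal_classM !ext_ideal_class ext_fracM ideal_classM.
Qed.

End Extension.

Section ExtensionComp.
Variables (K1 K2 K3 : fieldExtType rat).
Variables (i : {rmorphism K1 -> K2}) (j : {rmorphism K2 -> K3}).
Variable k : {rmorphism K1 -> K3}.
Hypothesis ijk : forall x, j (i x) = k x.

(** Compatibility is pointwise, so [k] may be [i] itself: a [j] that fixes the image of [i] fixes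
    every ideal extended along [i]. *)
Lemma ext_frac_comp I : ext_frac j (ext_frac i I) = ext_frac k I.
Proof.
apply/val_inj => /=; rewrite [ext_ideal i I]/ext_ideal ext_ideal_span.
congr ideal_span; rewrite image_comp; congr image.
exact/funext.
Qed.

Lemma ext_class_comp c : ext_class j (ext_class i c) = ext_class k c.
Proof.
elim/ideal_classW: c => I.
by rewrite (ext_ideal_class i) (ext_ideal_class j) (ext_ideal_class k) ext_frac_comp.
Qed.

End ExtensionComp.

Lemma ext_frac_id (K : fieldExtType rat) (i : {rmorphism K -> K}) I :
  (forall x, i x = x) -> ext_frac i I = I.
Proof.
move=> iE; have [gI _] := frac_idealP I; have [s IE] := gI.
apply/val_inj => /=; rewrite /ext_ideal (_ : i @` I = I :> set K).
  apply/seteqP; split; last exact: sub_ideal_span.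
  by apply: ideal_span_sub => //; apply: frac_submodule.
by rewrite (_ : (i : K -> K) = id) ?image_id //; apply/funext.
Qed.

Lemma ext_class_id (K : fieldExtType rat) (i : {rmorphism K -> K}) c :
  (forall x, i x = x) -> ext_class i c = c.
Proof. by move=> iE; elim/ideal_classW: c => I; rewrite ext_ideal_class ext_frac_id. Qed.

(** * Contents and Gauss's lemma *)

Section Content.
Variable K : fieldExtType rat.
Implicit Types (p q : {poly K}) (M I J : set K).

Definition content p : set K := ideal_span [set` (p : seq K)].

Lemma content_coef p j : content p p`_j.
Proof.
case: (ltnP j (size p)) => [jp|jp]; first by apply: sub_ideal_span; apply: mem_nth.
by rewrite nth_default //; case: (submodule_ideal_span [set` (p : seq K)]).
Qed.

Lemma submodule_content p : submodule (content p).
Proof. exact: submodule_ideal_span. Qed.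
Hint Resolve submodule_content : core.

Lemma content_sub p M : submodule M -> (forall j, M p`_j) -> content p `<=` M.
Proof. by move=> Mm Mp; apply: ideal_span_sub => // _ /(nthP 0)[j _ <-]. Qed.

Lemma content_mul_sub p q M : submodule M ->
  (forall j k, M (p`_j * q`_k)) -> mul_ideal (content p) (content q) `<=` M.
Proof.
move=> Mm Mpq; rewrite ideal_span_mul; apply: ideal_span_sub => //.
by move=> _ [_ /(nthP 0)[j _ <-] [_ /(nthP 0)[k _ <-] ->]]; apply: Mpq.
Qed.

(** The set is M + aI. *)
Lemma submodule_sum M I a : submodule M -> submodule I ->
  submodule [set z | exists2 y, I y & M (z - a * y)].
Proof.
move=> [M0 MD MZ] [I0 ID IZ]; split=> /=.
- by exists 0; rewrite // mulr0 subr0.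
- move=> x y [u Iu Mu] [v Iv Mv]; exists (u + v); first exact: ID.
  by rewrite mulrDr opprD addrACA; apply: MD.
- move=> c x Oc [u Iu Mu]; exists (c * u); first exact: IZ.
  by rewrite mulrCA -mulrBr; apply: MZ.
Qed.

Lemma submodule_prod_coef M p q j :
  submodule M -> (forall k l, M (p`_k * q`_l)) -> M (p * q)`_j.
Proof.
move=> [M0 MD _] Mpq; rewrite coefM.
by apply: (big_ind M) => // k _; apply: Mpq.
Qed.

Lemma content_mul_supset p q :
  content (p * q) `<=` mul_ideal (content p) (content q).
Proof.
apply: content_sub => // j; apply: submodule_prod_coef => // k m.
by apply: mem_mul_ideal; apply: content_coef.
Qed.

Definition behead_poly p := p - lead_coef p *: 'X^((size p).-1).

Lemma coef_behead_poly p j :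
  (behead_poly p)`_j = if j == (size p).-1 then 0 else p`_j.
Proof.
rewrite coefB coefZ coefXn; case: eqP => [->|_]; first by rewrite mulr1 subrr.
by rewrite mulr0 subr0.
Qed.

Lemma size_behead_poly p : p != 0 -> (size (behead_poly p) < size p)%N.
Proof.
move=> p0; rewrite -[X in (_ < X)%N]prednK ?size_poly_gt0 // ltnS.
apply/leq_sizeP => j jp; rewrite coef_behead_poly.
case: eqP => // /eqP jn; apply: nth_default.
by rewrite -[X in (X <= _)%N]prednK ?size_poly_gt0 // ltn_neqAle eq_sym jn.
Qed.

Lemma content_behead p : content (behead_poly p) `<=` content p.
Proof.
apply: content_sub => // j; rewrite coef_behead_poly; case: eqP => // _.
  by case: (submodule_content p).
exact: content_coef.
Qed.

(** The target is C + aB', with a the leading coefficient of p, C the content of pq and B' that of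
    the tail of q. It contains aB, because a times the leading coefficient of q lies in C. The
    coefficients of (tail of p) q = pq - a X^n q then lie in C + aB, hence in the target, and the
    hypothesis brings in the products of coefficients. *)
Lemma content_mul_lead p q :
  mul_ideal (content (behead_poly p)) (content q)
    `<=` content (behead_poly p * q) ->
  mul_ideal (content p) (content q) `<=`
  [set z | exists2 y, content (behead_poly q) y
                    & content (p * q) (z - lead_coef p * y)].
Proof.
set M := [set z | _] => IH.
have Mm : submodule M by exact: submodule_sum.
have Maq k : M (lead_coef p * q`_k).
  have [->|kq] := eqVneq k (size q).-1; last first.
    exists q`_k; last by rewrite subrr; case: (submodule_content (p * q)).
    by have := @content_coef (behead_poly q) k; rewrite coef_behead_poly (negPf kq).
  exists 0; first by case: (submodule_content (behead_poly q)).
  by rewrite mulr0 subr0 -lead_coefM; apply: content_coef.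
have MaB y : content q y -> M (lead_coef p * y).
  move: y; apply: content_sub => [|k /=]; last exact: Maq.
  have := submodule_colon (lead_coef p) Mm; congr submodule.
  by apply/funext => x /=; rewrite mulrC.
apply: content_mul_sub => // j k.
have [->|jp] := eqVneq j (size p).-1; first exact: Maq.
rewrite -[p`_j](_ : (behead_poly p)`_j = _); last first.
  by rewrite coef_behead_poly (negPf jp).
suff /(subset_trans IH) : content (behead_poly p * q) `<=` M.
  by apply; apply: mem_mul_ideal; apply: content_coef.
apply: content_sub => // m; rewrite mulrBl -scalerAl coefB coefZ -mulrN.
case: (Mm) => _ MD _; apply: MD.
  exists 0; last by rewrite mulr0 subr0; exact: content_coef.
  by case: (submodule_content (behead_poly q)).
apply: MaB; rewrite coefXnM; case: ifP => _.
  by rewrite oppr0; case: (submodule_content q).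
rewrite -mulN1r; case: (submodule_content q) => _ _; apply; last exact: content_coef.
exact/integersN/integers1.
Qed.

Lemma fractional_content p : p != 0 -> fractional_ideal (content p).
Proof.
move=> p0; split; first by exists p.
by exists (lead_coef p); [exact: content_coef|rewrite lead_coef_eq0].
Qed.

Lemma mul_ideal_cancel I J M : fractional_ideal M -> submodule I -> submodule J ->
  mul_ideal I M `<=` mul_ideal J M -> I `<=` J.
Proof.
move=> FM Im Jm IM; rewrite -(mul_1ideal Im) -(mul_1ideal Jm).
rewrite -(mul_inv_ideal FM) ![mul_ideal (mul_ideal M _) _]mul_idealC !mul_idealA.
exact: mul_ideal_le.
Qed.

(* With a, b the leading coefficients of p, q, and A, B, A', B' the contents of
   p, q and of their tails, the induction hypothesis gives AB <= C + aB' and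
   AB <= C + bA', where C is the content of pq. As ab is in C, it follows that
   (AB)^2 <= C(AB), and the invertible ideal AB cancels. *)
Lemma contentM p q : content (p * q) = mul_ideal (content p) (content q).
Proof.
apply/seteqP; split; first exact: content_mul_supset.
have [n] := ubnP (size p + size q); elim: n p q => // n IH p q; rewrite ltnS => pqn.
have [->|p0] := eqVneq p 0.
  apply: content_mul_sub => // j k.
  by rewrite coef0 !mul0r; case: (submodule_content 0).
have [->|q0] := eqVneq q 0.
  apply: content_mul_sub => // j k.
  by rewrite coef0 !mulr0; case: (submodule_content 0).
set A := content p; set B := content q; set C := content (p * q).
have FAB : fractional_ideal (mul_ideal A B).
  by apply: fractional_mul; apply: fractional_content.
apply: (mul_ideal_cancel FAB); [exact: submodule_mul|exact: submodule_content|].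
have lead1 := content_mul_lead (IH (behead_poly p) q _).
have lead2 := content_mul_lead (IH (behead_poly q) p _).
have {}lead1 : mul_ideal A B `<=` [set z | exists2 y, content (behead_poly q) y
                                     & C (z - lead_coef p * y)].
  by apply: lead1; apply: leq_trans pqn; rewrite ltn_add2r size_behead_poly.
have {}lead2 : mul_ideal A B `<=` [set z | exists2 x, content (behead_poly p) x
                                     & C (z - lead_coef q * x)].
  rewrite mul_idealC /C mulrC.
  by apply: lead2; apply: leq_trans pqn; rewrite addnC ltn_add2l size_behead_poly.
apply: mul_ideal_sub => [|z w ABz ABw]; first exact: submodule_mul.
have [y B'y Cz] := lead1 z ABz; have [x A'x Cw] := lead2 w ABw.
have Ay : mul_ideal A B (lead_coef p * y).
  by apply: mem_mul_ideal; [exact: content_coef|exact: content_behead].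
have ABxy : mul_ideal A B (x * y).
  by apply: mem_mul_ideal; exact: content_behead.
(* Each term is an element of C times an element of AB; in the last one, the product of the leading
   coefficients is a coefficient of pq. *)
have -> : z * w = (z - lead_coef p * y) * w
    + (w - lead_coef q * x) * (lead_coef p * y)
    + lead_coef p * lead_coef q * (x * y) by ring.
have [_ D _] := submodule_mul C (mul_ideal A B).
apply: (D); first by apply: (D); apply: mem_mul_ideal.
by apply: mem_mul_ideal; rewrite // -lead_coefM; apply: content_coef.
Qed.

End Content.

Section RationalContent.
Variable K : fieldExtType rat.

(** Up to sign [zcontents r] is the gcd of the coefficients, an integral combination of them by
    Bezout. *)
Lemma submodule_zcontents (M : set K) (r : {poly int}) : submodule M ->
  (forall j, M (r`_j)%:~R) -> M (zcontents r)%:~R.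
Proof.
move=> [M0 MD MZ] Mr; rewrite /zcontents rmorphM /=.
apply: (MZ); first exact: integers_int.
apply: (big_ind (fun n : nat => M (n%:Z)%:~R)) => // [m n Mm Mn|j _]; last first.
  by rewrite abszEsg rmorphM /=; apply: MZ => //; exact: integers_int.
have [u [v]] := Bezoutz m n; rewrite /gcdz /= => <-.
by rewrite rmorphD !rmorphM /=; apply: MD; apply: MZ => //; exact: integers_int.
Qed.

Lemma content_scale_int (x : K) (r : {poly int}) :
  content (x *: map_poly intr r) = ideal_span [set x * (zcontents r)%:~R].
Proof.
apply/seteqP; split.
  apply: content_sub => // j; rewrite coefZ coef_map /=.
  have -> : x * (r`_j)%:~R = ((zprimitive r)`_j)%:~R * (x * (zcontents r)%:~R).
    by rewrite {1}[r]zpolyEprim coefZ [(_ * _)%:~R]intrM mulrA mulrC.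
  case: (submodule_ideal_span [set x * (zcontents r)%:~R]) => _ _; apply.
    exact: integers_int.
  exact: sub_ideal_span.
apply: ideal_span_sub => [|_ ->]; first exact: submodule_content.
rewrite mulrC; have := submodule_colon x (submodule_content (x *: map_poly intr r)).
move/submodule_zcontents; apply => j /=.
by have := @content_coef _ (x *: map_poly intr r) j; rewrite coefZ coef_map mulrC.
Qed.

(** Clearing denominators reduces to integer polynomials, whose coefficients generate the ideal of
    their gcd. *)
Lemma content_rat (p : {poly K}) : p \is a polyOver 1%VS ->
  exists x, content p = ideal_span [set x].
Proof.
move=> /polyOver1P[q ->]; have [r [a a0 ->]] := rat_poly_scale q.
rewrite map_polyZ -map_poly_comp (@eq_map_poly _ _ _ intr) => [|n /=].
  by rewrite content_scale_int; eexists.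
by rewrite scaler_int.
Qed.

(** Makes every finitely generated ideal a content: [Poly] only drops trailing zeros. *)
Lemma content_Poly (s : seq K) : content (Poly s) = ideal_span [set` s].
Proof.
apply/seteqP; split.
  apply: content_sub => // j; rewrite coef_Poly.
  have [js|js] := ltnP j (size s); first by apply: sub_ideal_span; apply: mem_nth.
  by rewrite nth_default //; case: (submodule_ideal_span [set` s]).
apply: ideal_span_sub => [|_ /(nthP 0)[j _ <-]]; first exact: submodule_content.
by rewrite -coef_Poly; apply: content_coef.
Qed.

Lemma submodule0 : submodule [set 0 : K].
Proof. by split=> [//|x y -> ->|a x _ ->]; rewrite /= ?addr0 ?mulr0. Qed.

Lemma content_eq0 (p : {poly K}) x : content p = ideal_span [set x] ->
  (x == 0) = (p == 0).
Proof.
move=> px; apply/eqP/eqP => [x0|p0].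
  apply/polyP => j; rewrite coef0.
  have: content p p`_j by exact: content_coef.
  by rewrite px x0; apply: ideal_span_sub submodule0 _ _.
have: content p x by rewrite px; apply: sub_ideal_span.
by apply: content_sub submodule0 _ _ => j; rewrite p0 coef0.
Qed.

End RationalContent.

Lemma ext_content (K1 K2 : fieldExtType rat) (i : {rmorphism K1 -> K2}) p :
  ext_ideal i (content p) = content (map_poly i p).
Proof.
rewrite ext_ideal_span; apply/seteqP; split.
  apply: ideal_span_sub => [|_ [_ /(nthP 0)[j _ <-] <-]].
    exact: submodule_content.
  by rewrite -coef_map; apply: content_coef.
apply: content_sub => // j; rewrite (_ : _`_j = i p`_j) ?coef_map //.
have [jp|jp] := ltnP j (size p); last first.
  rewrite nth_default // rmorph0.
  by case: (submodule_ideal_span (i @` [set` (p : seq K1)])).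
by apply: sub_ideal_span; exists p`_j => //; apply: mem_nth.
Qed.

(** * Iteration and Lagrange's theorem *)

(** The Bezout relation is taken as um = vn + 1 with natural u and v, so that only nonnegative
    iterates of [g] occur. *)
Lemma iter_coprime (T : Type) (g : T -> T) x m n : (0 < m)%N -> coprime m n ->
  iter m g x = x -> iter n g x = x -> g x = x.
Proof.
move=> m0 /eqP mn gm gn.
have iterM a k : iter k g x = x -> iter (a * k) g x = x.
  by move=> gk; elim: a => // a IH; rewrite mulSn iterD IH.
case: (egcdnP n m0) => u v E _; move: (iterM u _ gm).
by rewrite E mn addn1 iterS iterM.
Qed.

(* Lagrange's theorem: the powers of g act semiregularly on A. When A is
   infinite, set_order A = 0 and there is nothing to prove. *)
Lemma iter_set_order (T : choiceType) (A : set T) (g : T -> T) : injective g ->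
  (forall x, A x -> A (g x)) ->
  (forall n x y, A x -> A y -> iter n g x = x -> iter n g y = y) ->
  forall x, A x -> iter (set_order A) g x = x.
Proof.
move=> injg Ag semireg x Ax; rewrite /set_order.
have [finA|infA] := pselect (finite_set A); last first.
  by rewrite /fset_set; case: pselect => // ?; rewrite cardfs0.
set B := fset_set A.
have inB y : (y \in B) = (y \in A) by rewrite /B in_fset_set.
have gB (y : B) : g (val y) \in B.
  by have := valP y; rewrite !inB !inE; apply: Ag.
pose h (y : B) : B := [` gB y]%fset.
have injh : injective h by move=> y z /(congr1 val) /= /injg /val_inj.
have iterh n y : val (iter n h y) = iter n g (val y).
  by elim: n => //= n ->.
have xB : x \in B by rewrite inB inE.
pose x0 : B := [` xB]%fset.
(* By semiregularity a period of one point is a period of every point, so all orbits have the same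
   length. *)
have ordh y : fingraph.order h y = fingraph.order h x0.
  have le (u v : B) : (fingraph.order h u <= fingraph.order h v)%N.
    have: iter (fingraph.order h v) h u = u.
      apply: val_inj; rewrite iterh; apply: (semireg _ (val v)).
      - by have := valP v; rewrite inB inE.
      - by have := valP u; rewrite inB inE.
      - by rewrite -iterh iter_order.
    (* A return to [u] before its full orbit length would have index 0, but orbit lengths are
       positive. *)
    move=> huu; rewrite leqNgt; apply/negP => lt.
    have := findex_iter lt; rewrite huu findex0 => E.
    by have := fingraph.order_gt0 h v; rewrite -E.
  by apply/eqP; rewrite eqn_leq !le.
(* The cardinality is the number of orbits times their common length. *)
have := @fcard_order_set _ h injh (fingraph.order h x0) predT.
rewrite -cardfE => <- //; last by apply/fintype.subsetP => y _; rewrite inE ordh.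
rewrite mulnC; elim: (fcard _ _) => [|k IH]; first by rewrite muln0.
by rewrite mulnS iterD IH -[x]/(val x0) -iterh iter_order.
Qed.

(** Left multiplication by [x] is semiregular: x^n y = y forces x^n = 1. *)
Lemma expg_set_order (G : groupType) (x : G) :
  (x ^+ set_order [set: G] = 1)%g.
Proof.
have iterE n y : iter n (fun z : G => x * z)%g y = (x ^+ n * y)%g.
  by elim: n => [|n IH]; rewrite ?mul1g // iterS IH mulgA expgS.
have := @iter_set_order _ [set: G] (fun z => x * z)%g (mulgI x).
move=> /(_ (fun _ _ => I)) /(_ _ 1%g I); rewrite iterE mulg1; apply.
move=> n y z _ _; rewrite !iterE => /(congr1 (fun t => t * y^-1)%g).
by rewrite mulgK mulgV => ->; rewrite mul1g.
Qed.

Lemma expg_coprime_eq1 (G : groupType) (x : G) m n :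
  (0 < m)%N -> coprime m n -> (x ^+ m = 1)%g -> (x ^+ n = 1)%g -> x = 1%g.
Proof.
have iterE k : iter k (fun z : G => x * z)%g 1%g = (x ^+ k)%g.
  by elim: k => [|k IH] //; rewrite iterS IH expgS.
move=> m0 mn xm xn; rewrite -[x]mulg1.
by apply: (iter_coprime m0 mn); rewrite iterE.
Qed.

(** Composition with [phi] acts semiregularly on the automorphisms, since these can be cancelled on
    the right; the result is read off at [id]. *)
Lemma iter_set_order_automorphisms (G : groupType) (phi : G -> G) (x : G) :
  automorphisms G phi -> iter (set_order (automorphisms G)) phi x = x.
Proof.
move=> [bphi mphi].
have autid : automorphisms G id by split=> //; exists id.
have iterE n (psi : G -> G) : iter n (comp phi) psi = iter n phi \o psi.
  by elim: n => //= n ->.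
have := @iter_set_order _ (automorphisms G) (comp phi).
move=> /(_ _ _ _ id autid); rewrite iterE => H.
have {}H : iter (set_order (automorphisms G)) phi \o id = id.
  apply: H.
  - move=> f g /funeqP fg; apply/funext => y; apply: (bij_inj bphi); exact: fg.
  - move=> psi [bpsi mpsi]; split; first exact: bij_comp.
    by move=> y z /=; rewrite mpsi mphi.
  - move=> n f g [bf _] _; rewrite !iterE => nf; apply/funext => y /=.
    have [f' _ f'K] := bf; rewrite -[g y]f'K.
    by have /(congr1 (@^~ (f' (g y)))) := nf.
by have /(congr1 (@^~ x)) := H.
Qed.

(** * Principal ideals and injectivity of extension *)

Lemma mul_ideal_span1 (K : fieldExtType rat) (x y : K) :
  mul_ideal (ideal_span [set x]) (ideal_span [set y]) = ideal_span [set x * y].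
Proof.
rewrite ideal_span_mul; congr ideal_span; apply/seteqP; split=> z /=.
  by move=> [_ -> [_ -> ->]].
by move=> ->; exists x => //; exists y.
Qed.

Lemma val_frac_mul (K : fieldExtType rat) (I J : frac_ideal K) :
  (I * J)%g = mul_ideal I J :> set K.
Proof. by []. Qed.

Lemma fractional_span1 (K : fieldExtType rat) (x : K) : x != 0 ->
  fractional_ideal (ideal_span [set x]).
Proof.
move=> x0; split; first by exists [:: x]; rewrite set_cons1.
by exists x => //; apply: sub_ideal_span.
Qed.

Lemma ext_ideal_inj (K1 K2 : fieldExtType rat) (i : {rmorphism K1 -> K2}) I J :
  fractional_ideal I -> fractional_ideal J -> ext_ideal i I = ext_ideal i J ->
  I = J.
Proof.
have le M N : fractional_ideal N -> ext_ideal i M = ext_ideal i N -> M `<=` N.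
  move=> FN MN x Mx; apply: (ext_ideal_contract FN (i := i)).
  by rewrite -MN; apply: sub_ideal_span; exists x.
by move=> FI FJ IJ; apply/seteqP; split; apply: le.
Qed.

(** * Galois action on ideal classes *)

Section GaloisAction.
Variable L : splittingFieldType rat.
Implicit Types (s t : gal_of {:L}) (r : seq (gal_of {:L})).
Implicit Types (c : class_group L).

(** Conjugation commutes with contents, and Gauss's lemma [contentM] turns the product of ideals
    into one of polynomials. *)
Lemma prod_ext_content r (I : frac_ideal L) (p : {poly L}) :
  I = content p :> set L ->
  (\prod_(s <- r) ext_frac s I)%g = content (\prod_(s <- r) map_poly s p) :> set L.
Proof.
move=> Ip; elim: r => [|s r IH].
  rewrite !big_nil /= -ideal_span1 -content_Poly; congr content.
  by rewrite /= cons_poly_def mul0r add0r.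
by rewrite !big_cons contentM -ext_content -IH -Ip.
Qed.

(* The product of the conjugates of the polynomial p has rational coefficients,
   so by Gauss's lemma the product of the conjugates of its content is generated
   by the content of a rational polynomial. *)
Lemma principal_prod_conj (I : frac_ideal L) : galois 1 {:L} ->
  principal (\prod_(s <- enum 'Gal({:L} / 1)) ext_frac s I)%g.
Proof.
move=> galL; have [[u Iu] [x Ix x0]] := frac_idealP I.
have Ip := Iu; rewrite -content_Poly in Ip.
set p := Poly u in Ip.
have p0 : p != 0.
  apply: contra_neq x0 => p0; move: Ix; rewrite Ip p0.
  by apply: content_sub (submodule0 L) _ _ => j; rewrite coef0.
pose P := \prod_(s in 'Gal({:L} / 1)%g) map_poly s p.
have P0 : P != 0.
  by apply/prodf_neq0 => s _; rewrite map_poly_eq0.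
have PQ : P \is a polyOver 1%VS.
  apply/polyOverP => j.
  have /galois_fixedField <- := galL; apply/fixedFieldP; first exact: memvf.
  move=> t Gt; rewrite -coef_map /=; congr (nth _ (polyseq _) _).
  rewrite /P rmorph_prod /= [RHS](reindex_inj (mulIg t)) /=.
  apply: eq_big => [s|s _]; first by rewrite groupMr.
  rewrite -map_poly_comp; apply: eq_map_poly => y /=.
  by rewrite galM ?memvf.
have [y Py] := content_rat PQ.
exists y; first by rewrite (content_eq0 Py).
by rewrite (prod_ext_content _ Ip) big_enum.
Qed.

Definition gal_class s c : class_group L := ext_class s c.

Lemma gal_class1 c : gal_class 1%g c = c.
Proof. by apply: ext_class_id => x; exact: gal_id. Qed.

Lemma gal_classM s t c : gal_class (s * t)%g c = gal_class t (gal_class s c).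
Proof.
by apply/esym/ext_class_comp => x; rewrite /= galM ?memvf.
Qed.

Lemma gal_classX s n c : gal_class (s ^+ n)%g c = iter n (gal_class s) c.
Proof.
elim: n => [|n IH]; first exact: gal_class1.
by rewrite expgSr gal_classM IH.
Qed.

Lemma gal_class_aut s : automorphisms (class_group L) (gal_class s).
Proof.
split; last exact: ext_classM.
by exists (gal_class s^-1%g) => c; rewrite -gal_classM ?mulgV ?mulVg gal_class1.
Qed.

(** If c is fixed, each conjugate of an ideal in c again lies in c, so the principal product of the
    conjugates has class c^|G|. *)
Lemma expg_gal_fixed_class c : galois 1 {:L} ->
  (forall s, s \in 'Gal({:L} / 1)%g -> gal_class s c = c) ->
  (c ^+ #|'Gal({:L} / 1)| = 1)%g.
Proof.
move=> galL; elim/ideal_classW: c => I cI.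
have /ideal_class1P <- := principal_prod_conj I galL.
rewrite cardE; have : {subset enum 'Gal({:L} / 1)%g <= 'Gal({:L} / 1)%g}.
  by move=> s; rewrite mem_enum.
elim: (enum _) => [|s r IH] sr; first by rewrite big_nil.
rewrite big_cons expgS ideal_classM IH => [|t tr]; last by rewrite sr // inE tr orbT.
by rewrite -ext_ideal_class [ext_class _ _]cI // sr // inE eqxx.
Qed.

(** The extension J = (a) of I is Galois invariant, so a power of J is generated by a product of as
    many conjugates of a; for the whole group this is the norm. *)
Lemma principal_descent (F : {subfield L}) (I : frac_ideal (subvs_of F)) :
  galois F {:L} -> principal (ext_frac (vsval : {rmorphism subvs_of F -> L}) I) ->
  principal (I ^+ #|'Gal({:L} / F)|)%g.
Proof.
move=> galF; set i := (vsval : {rmorphism _ -> _}); set J := ext_frac i I.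
move=> [a a0 Ja].
have JX r : {subset r <= 'Gal({:L} / F)%g} ->
    (J ^+ size r)%g = ideal_span [set \prod_(s <- r) s a] :> set L.
  elim: r => [|s r IH] sr.
    by rewrite big_nil -set_cons1 ideal_span1.
  rewrite expgS val_frac_mul IH => [|t tr]; last by rewrite sr // inE tr orbT.
  (* As [s] fixes F pointwise, composing it with the inclusion [i] gives [i] again. *)
  have <- : ext_frac s J = J.
    rewrite /J (@ext_frac_comp _ _ _ i s i) // => x.
    have sF : s \in 'Gal({:L} / F)%g by rewrite sr // inE eqxx.
    exact: (fixed_gal (subvf F) sF (subvsP x)).
  by rewrite /= (ext_ideal_span1 s Ja) mul_ideal_span1 big_cons.
pose N := galNorm F {:L} a.
have NF : N \in F by rewrite mem_galNorm ?memvf.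
have N0 : N != 0 by rewrite galNorm_eq0.
have iN : i (vsproj F N) = N by rewrite /= vsprojK.
have N'0 : vsproj F N != 0 by rewrite -(fmorph_eq0 i) iN.
(* The norm lies in F, and equality of fractional ideals of F can be tested in L. *)
exists (vsproj F N) => //; apply: (ext_ideal_inj (i := i)).
- exact: frac_idealP.
- exact: fractional_span1.
rewrite (ext_ideal_span1 (I := ideal_span _) i erefl) iN.
transitivity (ideal_set (ext_frac i (I ^+ #|'Gal({:L} / F)|)%g)) => //.
have -> m : ext_frac i (I ^+ m)%g = (J ^+ m)%g.
  by elim: m => [|m IH]; rewrite ?ext_frac1 // !expgS ext_fracM IH.
by rewrite cardE JX ?big_enum // => s; rewrite mem_enum.
Qed.

End GaloisAction.

(** * The exponent bound for abelian extensions of the rationals *)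

Lemma class_ext_expg_eq1 (L : splittingFieldType rat) (F : {subfield L}) :
  galois 1 {:L} -> abelian 'Gal({:L} / 1) ->
  coprime (\dim {:L}) (set_order [set: class_group L]) ->
  coprime (\dim F) (\dim_F {:L}) ->
  coprime (\dim F) (set_order (automorphisms (class_group L))) ->
  forall x : class_group (subvs_of F), (x ^+ \dim_F {:L} = 1)%g.
Proof.
move=> galL abelL co_h co_f co_aut x.
have f0 : (0 < \dim F)%N by exact: adim_gt0.
have galF : galois F {:L} by apply: galoisS galL; rewrite sub1v subvf.
have HG : 'Gal({:L} / F)%g \subset 'Gal({:L} / 1)%g by apply: galS; apply: sub1v.
have oG : #|'Gal({:L} / 1)%g| = \dim {:L} by rewrite -galois_dim // dimv1 divn1.
have oH : #|'Gal({:L} / F)%g| = \dim_F {:L} by rewrite -galois_dim.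
have dimF : (\dim_F {:L} * \dim F = \dim {:L})%N by rewrite -dim_sup_field ?subvf.
pose i : {rmorphism subvs_of F -> L} := vsval.
pose c := ext_class i x.
have cfix s : s \in 'Gal({:L} / 1)%g -> gal_class s c = c.
  move=> Gs; apply: (iter_coprime f0 co_f); rewrite -gal_classX.
    (* The quotient by this normal subgroup has order [\dim F], which kills the image of [s]. *)
    have Hs : (s ^+ \dim F)%g \in 'Gal({:L} / F)%g.
      have nH := fintype.subsetP (sub_abelian_norm abelL HG).
      apply: coset_idr; first by rewrite nH ?groupX.
      rewrite morphX ?nH //.
      have -> : \dim F = #|'Gal({:L} / 1) / 'Gal({:L} / F)|%g.
        rewrite card_quotient ?sub_abelian_norm // -divgS // oG oH.
        by rewrite -{1}dimF mulKn // -oH.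
      by rewrite expg_cardG // mem_quotient.
    apply: (@ext_class_comp _ _ _ i (s ^+ \dim F)%g i) => y.
    exact: (fixed_gal (subvf F) Hs (subvsP y)).
  (* The action of s^m, with m = [\dim_F {:L}], has the coprime periods [\dim F], since [s] to the
     group order is 1, and the number of automorphisms. *)
  apply: (iter_coprime f0 co_aut); last first.
    exact/iter_set_order_automorphisms/gal_class_aut.
  by rewrite -gal_classX -expgM dimF -oG expg_cardG // gal_class1.
have c1 : c = 1%g.
  apply: (expg_coprime_eq1 _ co_h); first by rewrite adim_gt0.
    by rewrite -oG expg_gal_fixed_class.
  exact: expg_set_order.
elim/ideal_classW: x @c c1 {cfix} => I c; rewrite /c ext_ideal_class.
move=> /ideal_class1P /(principal_descent galF); rewrite oH => /ideal_class1P <-.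
by elim: (\dim_F _) => [|m IH] //; rewrite !expgS ideal_classM IH.
Qed.

(** * Cyclotomic fields *)

Lemma splittingField_cyclotomic (K : fieldExtType rat) (zeta : K) n :
  n.-primitive_root zeta -> <<1; zeta>>%VS = fullv ->
  splittingFieldFor 1 ('X^n - 1) {:K}.
Proof.
move=> prim_z genK; pose r := codom (fun i : 'I_n => zeta ^+ i).
have Dr: 'X^n - 1 = \prod_(y <- r) ('X - y%:P).
  by rewrite -(factor_Xn_sub_1 prim_z) big_mkord big_image.
exists r; first by rewrite -Dr eqpxx.
apply/eqP; rewrite eqEsubv subvf -genK -adjoin_seq1 adjoin_seqSr //.
apply/allP => /=.
by rewrite andbT -root_prod_XsubC -Dr; apply/unity_rootP/prim_expr_order.
Qed.

(** Equality of the structures, rather than an isomorphism, allows K to be replaced by L in all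
    hypotheses. *)
Lemma exists_splittingField (K : fieldExtType rat) p :
  p \is a polyOver 1%VS -> splittingFieldFor 1 p {:K} ->
  exists L : splittingFieldType rat, L = K :> fieldExtType rat.
Proof.
move=> Qp splitp.
have K_ax : FieldExt_isSplittingField _ K by constructor; exists p.
exists (HB.pack_for (splittingFieldType rat) K K_ax).
by case: K p Qp splitp K_ax => T c p Qp splitp K_ax.
Qed.

Lemma galois_cyclotomic (L : splittingFieldType rat) (zeta : L) n :
  n.-primitive_root zeta -> <<1; zeta>>%VS = fullv -> galois 1 {:L}.
Proof.
move=> prim_z genL; apply/splitting_galoisField; exists ('X^n - 1).
have n0 := prim_order_gt0 prim_z; split.
- by rewrite rpredB ?rpred1 ?rpredX //= polyOverX.
- apply: separable_Xn_sub_1.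
  by rewrite -(rmorph_nat (in_alg L)) fmorph_eq0 pnatr_eq0 -lt0n.
- exact: splittingField_cyclotomic prim_z genL.
Qed.

(** An automorphism is determined by the power of [zeta] to which it sends [zeta], and exponents
    multiply under composition. *)
Lemma abelian_cyclotomic (L : splittingFieldType rat) (zeta : L) n :
  n.-primitive_root zeta -> <<1; zeta>>%VS = fullv -> abelian 'Gal({:L} / 1).
Proof.
move=> prim_z genL; apply/centsP => s Gs t Gt; apply/eqP.
have := @gal_adjoin_eq _ _ 1%AS zeta; rewrite genL => -> //; rewrite ?groupM //.
have zetaX (u : gal_of {:L}) : exists k, u zeta = zeta ^+ k.
  have [|k ->] := prim_rootP prim_z (x := u zeta); last by exists k.
  by rewrite -rmorphXn prim_expr_order // rmorph1.
have [[j sE] [k tE]] := (zetaX s, zetaX t).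
by rewrite !galM ?memvf // sE tE !rmorphXn /= sE tE -!exprM mulnC.
Qed.

(** X^n - 1 is the product of the Phi_d with d | n, so [zeta] is a root of some Phi_d; then zeta^d =
    1, whence n | d and d = n. *)
Lemma root_Cyclotomic (F : fieldType) (zeta : F) n :
  n.-primitive_root zeta -> root (map_poly intr 'Phi_n) zeta.
Proof.
move=> prim_z; have n0 := prim_order_gt0 prim_z.
have XE d : (0 < d)%N ->
    \prod_(e <- divisors d) map_poly intr 'Phi_e = 'X^d - 1 :> {poly F}.
  move=> d0; rewrite -rmorph_prod /= prod_Cyclotomic //.
  by rewrite rmorphB /= rmorph1 map_polyXn.
have: root ('X^n - 1) zeta by apply/unity_rootP/prim_expr_order.
rewrite -XE // rootE horner_prod prodf_seq_eq0 => /hasP[d dn /= Phid].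
suff <- : d = n by [].
have d0 : (0 < d)%N by move: dn; rewrite -dvdn_divisors //; apply: dvdn_gt0.
have : root ('X^d - 1) zeta.
  rewrite -XE // rootE horner_prod prodf_seq_eq0.
  by apply/hasP; exists d; rewrite -?dvdn_divisors.
move=> /unity_rootP/eqP; rewrite -(prim_order_dvd prim_z) => nd.
by apply/eqP; rewrite eqn_dvd nd andbT dvdn_divisors.
Qed.

(** The minimal polynomial q of [zeta] divides Phi_n. For the reverse inequality of degrees, the
    irreducibility of Phi_n is carried over from [algC]. *)
Lemma dim_cyclotomic (K : fieldExtType rat) (zeta : K) n :
  n.-primitive_root zeta -> \dim <<1; zeta>> = totient n.
Proof.
move=> prim_z; rewrite dim_Fadjoin dimv1 muln1; apply: succn_inj.
rewrite -size_minPoly.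
have n0 := prim_order_gt0 prim_z; have [w prim_w] := C_prim_root_exists n0.
have /polyOver1P[q qE] := minPolyOver 1 zeta.
have intE (R : fieldType) (g : {rmorphism rat -> R}) :
    map_poly intr 'Phi_n = map_poly g (map_poly intr 'Phi_n).
  by rewrite -map_poly_comp; apply: eq_map_poly => m /=; rewrite rmorph_int.
have dvdPhi : q %| map_poly intr 'Phi_n.
  rewrite -(dvdp_map (in_alg K)) -qE -intE minPoly_dvdp ?root_Cyclotomic //.
  by apply/polyOverP => m; rewrite coef_map rpred_int.
have szq : size (minPoly 1 zeta) = size q by rewrite qE size_map_poly.
have szPhi : size (map_poly intr 'Phi_n : {poly rat}) = (totient n).+1.
  by rewrite size_rat_int_poly size_Cyclotomic.
apply/eqP; rewrite eqn_leq szq -{1}szPhi dvdp_leq ?andbT -?size_poly_gt0 ?szPhi //=.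
have szq1 : size (map_poly ratr q : {poly algC}) != 1%N.
  by rewrite size_map_poly -szq size_minPoly.
(* A complex root of q is a root of Phi_n, hence a primitive n-th root of unity; its minimal
   polynomial has degree [totient n] and divides q. *)
have [z qz] := closed_rootP _ szq1.
have prim_z' : n.-primitive_root z.
  rewrite -(root_cyclotomic prim_w) -(Cintr_Cyclotomic prim_w) (intE _ ratr).
  by apply: root_dvdp qz; rewrite dvdp_map.
have [p [pE _] dvdp] := minCpolyP z.
have := size_cyclotomic z n; rewrite -minCpoly_cyclotomic // pE size_map_poly => <-.
apply: dvdp_leq; last by rewrite -dvdp.
by rewrite -size_poly_gt0 -szq size_minPoly.
Qed.

(** * Existence of the exponent and conclusion *)

Lemma is_exponent_ex (G : groupType) m : (0 < m)%N ->
  (forall x : G, x ^+ m = 1)%g -> exists2 e, is_exponent G e & (e <= m)%N.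
Proof.
move=> m0 Gm.
pose P e := (0 < e)%N && `[< forall x : G, (x ^+ e = 1)%g >].
have Pm : P m by rewrite /P m0; apply/asboolP.
have exP : exists e, P e by exists m.
case: (ex_minnP exP) => e /andP[e0 /asboolP Ge] emin.
exists e; last exact: emin.
by split=> // k k0 Gk; apply: emin; rewrite /P k0; apply/asboolP.
Qed.

Theorem theorem1p6 (l : nat) (K : fieldExtType rat) (zeta : K) (f : nat)
    (F : {subfield K}) :
  prime l ->
  l.-primitive_root zeta -> <<1; zeta>>%VS = fullv ->
  coprime l.-1 (set_order [set: class_group K]%classic) ->
  (0 < f)%N -> (f %| l.-1)%N ->
  coprime f (l.-1 %/ f) ->
  coprime f (set_order (automorphisms (class_group K))) ->
  \dim F = f :> nat ->
  exists2 e, is_exponent (class_group (subvs_of F)) e & (e <= l.-1 %/ f)%N.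
Proof.
move=> l_prime prim_z genK co_h f0 fl co_f co_aut dimF.
have Q_Xl1 : ('X^l - 1 : {poly K}) \is a polyOver 1%VS.
  by rewrite rpredB ?rpred1 ?rpredX //= polyOverX.
have [L LK] := exists_splittingField Q_Xl1 (splittingField_cyclotomic prim_z genK).
subst K; have galL := galois_cyclotomic prim_z genK.
have abelL := abelian_cyclotomic prim_z genK.
have dimL : \dim {:L} = l.-1.
  by rewrite -genK (dim_cyclotomic prim_z) totient_prime.
apply: is_exponent_ex.
  by rewrite divn_gt0 // dvdn_leq // -subn1 subn_gt0 prime_gt1.
by rewrite -dimL -dimF; apply: class_ext_expg_eq1; rewrite ?dimL ?dimF.
Qed.
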